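(* For a positive integer $m$ let $\tau(m)$ denote the number of positive divisors of $m$ and $\omega(m)$ the number of distinct prime factors of $m$, and for positive integers $n$ define $f(n):=\sum_{1\le k\le n} \tau(2^k-1)$. For a positive integer $d$ let $\Phi_d(X)=\prod_{1\le h\le d,\ (h,d)=1}(X-e^{2\pi i h/d})\in\mathbb{Z}[X]$ be the $d$th cyclotomic polynomial. Assume that the inequality $\omega(\Phi_d(2))\le 10\log d$ (natural logarithm) holds for all integers $d\ge 2$ with at most finitely many exceptions. Then $$\lim_{n\to\infty}\frac{f(2n)}{f(n)}=\infty.$$
   Context: $\tau(m)$ is the number of positive divisors of $m$, $\omega(m)$ the number of distinct prime divisors of $m$, $\log$ the natural logarithm, and $\Phi_d$ the $d$th cyclotomic polynomial. *)

(* Defs.v *)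
From HB Require Import structures.
From mathcomp Require Import all_boot all_order all_algebra.
From mathcomp Require Import cyclotomic.
From mathcomp Require Import all_classical all_reals all_analysis.

Set Implicit Arguments.
Unset Strict Implicit.
Unset Printing Implicit Defensive.

Definition num_divisors (m : nat) : nat := size (divisors m).

Definition num_prime_divisors (m : nat) : nat := size (primes m).

Definition sum_num_divisors_mersenne (n : nat) : nat :=
  (\sum_(1 <= k < n.+1) num_divisors (2 ^ k - 1))%N.

(* 'Phi_d has coefficients in int, so the value is taken to nat by absz;
   this is harmless since 'Phi_d.[2] > 0 for d >= 2. *)
Definition cyclotomic_at2 (d : nat) : nat := `|('Phi_d).[2]%R|%N.

(* Main.v *)
Require Import Defs.
From HB Require Import structures.
From mathcomp Require Import all_boot all_order all_algebra.
From mathcomp Require Import cyclotomic.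
From mathcomp Require Import all_classical all_reals all_analysis.
From mathcomp Require Import zify ring lra.

(* Write t k for the number of divisors of 2^k - 1 and f n for the sum of the t k
   with k <= n. Since 2^(2k) - 1 = (2^k - 1)(2^k + 1) with coprime factors, and
   2^k + 1 has a divisor 2^(k_2 d) + 1 for each divisor d of the odd part of k
   (k_2 the 2-part), t (2k) >= C * t k unless the odd part of k has fewer than C
   divisors. For such an exceptional k, k has O(log k) divisors, so the hypothesis
   gives omega(2^k - 1) = O((log k)^2) and t k <= exp(O((log k)^3)). This is
   negligible: if k = (11 * 13 * 17 * 19)^a, every divisor d > 1 of k contributes
   a primitive prime divisor of 2^d - 1, so that t k >= 2^((a + 1)^4 - 1). *)

Set Implicit Arguments.
Unset Strict Implicit.
Unset Printing Implicit Defensive.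

Import Order.TTheory GRing.Theory Num.Theory.
Import numFieldNormedType.Exports.

(** * Bounds for the number of divisors *)

Lemma num_divisors_gt0 m : 0 < m -> 0 < num_divisors m.
Proof.
move=> m0; rewrite /num_divisors; have := divisors_id m0.
by case: (divisors m).
Qed.

Lemma num_divisors_subset m (s : seq nat) : 0 < m -> uniq s ->
  {in s, forall d, d %| m} -> size s <= num_divisors m.
Proof.
move=> m0 us sm; apply: uniq_leq_size us _ => d /sm.
by rewrite dvdn_divisors.
Qed.

(** Each divisor [d] of [m * n] is [gcdn d m] times a cofactor that divides [n]. *)
Lemma num_divisors_subM m n : 0 < m -> 0 < n ->
  num_divisors (m * n) <= num_divisors m * num_divisors n.
Proof.
move=> m0 n0; rewrite /num_divisors -(size_allpairs muln).
apply: uniq_leq_size (divisors_uniq _) _ => d.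
rewrite -dvdn_divisors ?muln_gt0 ?m0 // => dmn.
have g0 : 0 < gcdn d m by rewrite gcdn_gt0 m0 orbT.
have -> : d = gcdn d m * (d %/ gcdn d m) by rewrite mulnC divnK ?dvdn_gcdl.
apply: allpairs_f; rewrite -dvdn_divisors ?dvdn_gcdr //.
rewrite -(@Gauss_dvdr _ (m %/ gcdn d m)); last first.
  by rewrite /coprime -(eqn_pmul2r g0) muln_gcdl !divnK ?dvdn_gcdl ?dvdn_gcdr ?mul1n.
by rewrite -(dvdn_pmul2r g0) mulnAC !divnK ?dvdn_gcdl ?dvdn_gcdr.
Qed.

(** The products [d * e] with [d %| m] and [e %| n] are distinct divisors of [m * n], since
    [gcdn (d * e) m = d] recovers the first factor. *)
Lemma num_divisors_supM m n : 0 < m -> 0 < n -> coprime m n ->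
  num_divisors m * num_divisors n <= num_divisors (m * n).
Proof.
move=> m0 n0 cmn; rewrite -(size_allpairs muln).
apply: num_divisors_subset => [||_ /allpairsP[[d e] /= [+ + ->]]]; last 2 first.
- apply: allpairs_uniq; rewrite ?divisors_uniq //.
  move=> _ _ /allpairsP[[d e] [/= + + ->]] /allpairsP[[d' e'] [/= + + ->]] /=.
  rewrite -!dvdn_divisors // => dm en dm' en' eqde.
  have gcdE a b : a %| m -> b %| n -> gcdn (a * b) m = a.
    move=> am bn; rewrite gcdnC Gauss_gcdl; first exact/gcdn_idPr.
    exact: coprime_dvdr bn cmn.
  have eqd : d = d' by rewrite -(gcdE d e) // eqde gcdE.
  move: eqde; rewrite -eqd => /eqP.
  by rewrite eqn_pmul2l ?(dvdn_gt0 m0) // => /eqP ->.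
- by rewrite -!dvdn_divisors // => dm en; rewrite dvdn_mul.
by rewrite muln_gt0 m0.
Qed.

Lemma num_divisors_pfactor p a : prime p -> num_divisors (p ^ a) = a.+1.
Proof.
move=> pp; have p1 := prime_gt1 pp; apply/eqP; rewrite eqn_leq.
rewrite -(size_iota 0 a.+1) -(size_map (expn p)); apply/andP; split.
  apply: uniq_leq_size (divisors_uniq _) _ => d.
  rewrite -dvdn_divisors ?expn_gt0 ?prime_gt0 // => /(dvdn_pfactor _ _ pp)[b ba ->].
  by apply: map_f; rewrite mem_iota ltnS.
apply: num_divisors_subset => [||_ /mapP[b + ->]].
- by rewrite expn_gt0 prime_gt0.
- by rewrite map_inj_uniq ?iota_uniq //; apply: expnI.
- by rewrite mem_iota ltnS => ba; rewrite dvdn_exp2l.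
Qed.

(** For each [p] in [s] the [p]-part of [m] splits off as a coprime factor with at least two
    divisors. *)
Lemma exp2_leq_num_divisors (s : seq nat) m : 0 < m -> uniq s ->
  {in s, forall p, prime p && (p %| m)} -> 2 ^ size s <= num_divisors m.
Proof.
elim: s m => [|p s IHs] m m0 /=; first by rewrite num_divisors_gt0.
move=> /andP[ps us] sm.
have /andP[pp pm] : prime p && (p %| m) by apply: sm; rewrite mem_head.
rewrite -(partnC p m0) expnS.
apply: leq_trans (num_divisors_supM _ _ _); rewrite ?part_gt0 ?coprime_partC //.
apply: leq_mul.
  by rewrite p_part num_divisors_pfactor // ltnS logn_gt0 mem_primes pp m0.
apply: IHs us _ => [|q qs]; first exact: part_gt0.
have /andP[pq qm] : prime q && (q %| m) by apply: sm; rewrite inE qs orbT.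
rewrite pq /=; move: qm; rewrite -{1}(partnC p m0) Euclid_dvdM //.
case/orP => //; rewrite p_part Euclid_dvdX // dvdn_prime2 // => /andP[/eqP qp _].
by rewrite -qp qs in ps.
Qed.

Lemma num_divisors_leq_exp m b : 0 < m -> (forall p, logn p m < b) ->
  num_divisors m <= b ^ num_prime_divisors m.
Proof.
move=> m0 mb; rewrite {1}(prod_prime_decomp m0) prime_decompE big_map /=.
rewrite /num_prime_divisors.
have : all prime (primes m).
  by apply/allP => p; rewrite mem_primes => /andP[].
elim: (primes m) => [|p s IHs /= /andP[pp ps]]; first by rewrite big_nil.
rewrite big_cons expnS.
have pv0 q : prime q -> 0 < q ^ logn q m by move=> /prime_gt0; rewrite expn_gt0 => ->.
apply: leq_trans (num_divisors_subM (pv0 p pp) _) _.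
  by rewrite big_seq prodn_cond_gt0 // => q /(allP ps) /pv0.
by rewrite leq_mul ?IHs // num_divisors_pfactor.
Qed.

(** * Primitive prime divisors of Mersenne numbers *)

Lemma dvdn_pred_exp x m n : m %| n -> x ^ m - 1 %| x ^ n - 1.
Proof.
by case/dvdnP => k ->; rewrite mulnC expnM !subn1 (predn_exp (x ^ m)) dvdn_mulr.
Qed.

(** For [m > 0], Bezout gives [a * m = b * n + gcdn m n]. Subtracting [2 ^ (b * n) - 1] from
    [2 ^ (a * m) - 1] leaves [2 ^ (b * n) * (2 ^ gcdn m n - 1)], and [q] is coprime to the first
    factor. *)
Lemma dvdn_exp2_gcd q m n : q %| 2 ^ m - 1 -> q %| 2 ^ n - 1 ->
  q %| 2 ^ gcdn m n - 1.
Proof.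
case: (posnP m) => [->|m0]; first by rewrite gcd0n.
have dvdM j k : q %| 2 ^ j - 1 -> q %| 2 ^ (k * j) - 1.
  by move=> qj; rewrite (dvdn_trans qj) // dvdn_pred_exp // dvdn_mull.
case: (egcdnP n m0) => a b Eab _ /(dvdM _ a); rewrite Eab => qa /(dvdM _ b) qb.
have : q %| 2 ^ (b * n) * (2 ^ gcdn m n - 1).
  suff -> : 2 ^ (b * n) * (2 ^ gcdn m n - 1) =
      2 ^ (b * n + gcdn m n) - 1 - (2 ^ (b * n) - 1) by rewrite dvdn_sub.
  by rewrite expnD mulnBr muln1 subnBA ?expn_gt0 // subnK // muln_gt0 !expn_gt0.
rewrite Gauss_dvdr // (coprime_dvdl qb) // subn1 coprimePn //.
by rewrite expn_gt0.
Qed.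

(* If every prime q dividing 2^d - 1 divided some 2^(d/p) - 1 with p prime, then
   the q-parts would agree, because the cofactor is congruent to p modulo q and
   q <> p by the coprimality hypothesis (Fermat). So 2^d - 1 would divide the
   product of the 2^(d/p) - 1, which is too small. *)
Lemma primitive_prime_divisor d : 1 < d ->
  {in primes d, forall p, coprime d p.-1} ->
  \sum_(p <- primes d) d %/ p < d ->
  exists q, [/\ prime q, q %| 2 ^ d - 1 &
    forall e, e %| d -> q %| 2 ^ e - 1 -> e = d].
Proof.
move=> d1 dco dsum; have d0 := ltnW d1; apply: contrapT => noq.
have N0 : 0 < 2 ^ d - 1 by rewrite subn_gt0 -{1}(expn0 2) ltn_exp2l.
suff : 2 ^ d - 1 %| \prod_(p <- primes d) (2 ^ (d %/ p) - 1).
  have prod_gt0 : 0 < \prod_(p <- primes d) (2 ^ (d %/ p) - 1).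
    rewrite big_seq prodn_cond_gt0 // => p.
    rewrite mem_primes => /and3P[pp _ pd].
    by rewrite subn_gt0 -{1}(expn0 2) ltn_exp2l // divn_gt0 ?prime_gt0 // dvdn_leq.
  move=> /(dvdn_leq prod_gt0); apply/negP; rewrite -ltnNge.
  apply: (@leq_ltn_trans (2 ^ d.-1)).
    rewrite (@leq_trans (2 ^ (\sum_(p <- primes d) d %/ p))) //.
      by rewrite expn_sum leq_prod // => p _; rewrite leq_subr.
    by rewrite leq_exp2l // -ltnS prednK.
  rewrite ltn_subRL -{2}(prednK d0) expnS mul2n -addnn ltn_add2r.
  by rewrite -{1}(expn0 2) ltn_exp2l // -ltnS prednK.
apply/(dvdn_partP _ N0) => q; rewrite mem_primes => /and3P[pq _ qN].
have [p [pp pd qp]] : exists p, [/\ prime p, p %| d & q %| 2 ^ (d %/ p) - 1].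
  apply: contrapT => nop; apply: noq; exists q; split => // e ed qe.
  (* If [e] is a proper divisor of [d] and the prime [p] divides [d %/ e], then [e] divides
     [d %/ p]. *)
  apply: contrapT => ned; apply: nop; exists (pdiv (d %/ e)).
  have e0 : 0 < e := dvdn_gt0 d0 ed.
  have de1 : 1 < d %/ e.
    rewrite ltn_divRL // mul1n ltn_neqAle dvdn_leq // andbT.
    exact/eqP.
  split; [exact: pdiv_prime | exact: dvdn_trans (pdiv_dvd _) (dvdn_div ed) |].
  apply: dvdn_trans qe _; apply: dvdn_pred_exp.
  rewrite dvdn_divRL ?(dvdn_trans (pdiv_dvd _) (dvdn_div ed)) //.
  by rewrite mulnC -dvdn_divRL // pdiv_dvd.
apply: (@dvdn_trans (2 ^ (d %/ p) - 1)); last first.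
  rewrite (big_rem p) ?mem_primes ?pp ?d0 //=; exact: dvdn_mulr.
set x := 2 ^ (d %/ p) in qp *.
have x0 : 0 < x by rewrite expn_gt0.
have NE : 2 ^ d - 1 = (x - 1) * \sum_(i < p) x ^ i.
  by rewrite !subn1 -predn_exp /x -expnM divnK.
suff qS : ~~ (q %| \sum_(i < p) x ^ i).
  have S0 : 0 < \sum_(i < p) x ^ i by rewrite lt0n; apply: contraNneq qS => ->.
  rewrite p_part -(@Gauss_dvdl _ _ (\sum_(i < p) x ^ i)).
    by rewrite -NE pfactor_dvdnn.
  by rewrite coprimeXl // prime_coprime.
have xi i : x ^ i = 1 %[mod q].
  have /eqP x1 : x == 1 %[mod q] by rewrite eqn_mod_dvd.
  by rewrite -modnXm x1 modnXm exp1n.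
rewrite /dvdn -modn_summ (eq_bigr (fun=> 1 %% q)) => [|i _]; last exact: xi.
rewrite modn_summ sum1_card card_ord -/(dvdn q p) dvdn_prime2 //.
apply/eqP => eqp; subst q.
have p2 : coprime p 2.
  apply: (coprime_dvdl qN); rewrite -(@coprime_pexpr d) // subn1 coprimePn //.
  by rewrite expn_gt0.
have fermat : p %| 2 ^ p.-1 - 1.
  rewrite -(Gauss_dvdr _ p2) mulnBr -expnS prednK ?prime_gt0 //.
  by rewrite muln1 -eqn_mod_dvd ?fermat_little //;
    rewrite -{1}(expn1 2) leq_exp2l ?prime_gt0.
have := dvdn_exp2_gcd qN fermat.
have /dco/eqP -> : p \in primes d by rewrite mem_primes pp d0.
by rewrite dvdn1 => /eqP p1; rewrite p1 in pp.
Qed.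

(** A primitive prime shared by [d] and [e] divides [2 ^ gcdn d e - 1], so [d = gcdn d e = e]:
    distinct divisors get distinct primes. The successor accounts for the divisor 1. *)
Lemma num_divisors_leq_primes_mersenne k : 0 < k ->
  (forall d, d %| k -> 1 < d -> exists q, [/\ prime q, q %| 2 ^ d - 1 &
    forall e, e %| d -> q %| 2 ^ e - 1 -> e = d]) ->
  num_divisors k <= (num_prime_divisors (2 ^ k - 1)).+1.
Proof.
move=> k0 hk.
have N0 : 0 < 2 ^ k - 1 by rewrite subn_gt0 -{1}(expn0 2) ltn_exp2l.
have /choice[Q hQ] : forall d, exists q, d %| k -> 1 < d ->
    [/\ prime q, q %| 2 ^ d - 1 & forall e, e %| d -> q %| 2 ^ e - 1 -> e = d].
  move=> d; case: (boolP ((d %| k) && (1 < d))) => [/andP[dk d1]|nd].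
    by have [q hq] := hk d dk d1; exists q.
  by exists 0 => dk d1; rewrite dk d1 in nd.
rewrite /num_divisors (perm_size (perm_to_rem (_ : 1 \in divisors k))) /=; last first.
  by rewrite -dvdn_divisors.
rewrite ltnS -(size_map Q).
have memP d : d \in rem 1 (divisors k) -> d %| k /\ 1 < d.
  rewrite mem_rem_uniq ?divisors_uniq // inE -dvdn_divisors // => /andP[d1 dk].
  by split => //; rewrite ltn_neqAle eq_sym d1 (dvdn_gt0 k0 dk).
apply: uniq_leq_size => [|_ /mapP[d /memP[dk d1] ->]]; last first.
  have [pq qd _] := hQ d dk d1; rewrite mem_primes pq N0.
  exact: dvdn_trans qd (dvdn_pred_exp _ dk).
rewrite map_inj_in_uniq ?rem_uniq ?divisors_uniq //.
move=> d e /memP[dk d1] /memP[ek e1] eqQ.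
have [_ qd hd] := hQ d dk d1; have [_ qe he] := hQ e ek e1.
rewrite -eqQ in qe he; have qg := dvdn_exp2_gcd qd qe.
by rewrite -(hd _ (dvdn_gcdl d e) qg) -[RHS](he _ (dvdn_gcdr d e) qg).
Qed.

(* Four primes are needed for the exponent (log k)^4 to beat the (log k)^3 of
   num_divisors_mersenne_leq. These four satisfy the hypotheses of
   primitive_prime_divisor: each is coprime to the predecessors of all of them,
   and their reciprocals sum to less than 1. *)
Lemma exp2_leq_num_divisors_mersenne a :
  2 ^ (a.+1 ^ 4).-1 <= num_divisors (2 ^ ((11 * 13 * 17 * 19) ^ a) - 1).
Proof.
set b := 11 * 13 * 17 * 19; have k0 : 0 < b ^ a by rewrite expn_gt0.
have N0 : 0 < 2 ^ (b ^ a) - 1 by rewrite subn_gt0 -{1}(expn0 2) ltn_exp2l.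
apply: leq_trans (exp2_leq_num_divisors N0 (primes_uniq _) _); last first.
  by move=> p; rewrite mem_primes => /and3P[-> _ ->].
rewrite leq_exp2l // -ltnS prednK ?expn_gt0 //.
apply: leq_trans (num_divisors_leq_primes_mersenne k0 _).
  have step x m p : prime p -> 0 < m -> coprime m (p ^ a) ->
      x <= num_divisors m -> x * a.+1 <= num_divisors (m * p ^ a).
    move=> pp m0 cmp xm; have pa0 : 0 < p ^ a by rewrite expn_gt0 prime_gt0.
    apply: leq_trans (num_divisors_supM m0 pa0 cmp).
    by rewrite num_divisors_pfactor // leq_mul2r xm orbT.
  rewrite /b !expnMn expnSr expnSr expnSr expn1.
  do 3! [apply: (step _ _ _) => //;
    rewrite -?expnMn ?expn_gt0 ?coprimeXl ?coprimeXr // ?expnMn].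
  by rewrite num_divisors_pfactor.
move=> d dk d1; have d0 := ltnW d1.
have prd p : p \in primes d -> p \in [:: 11; 13; 17; 19].
  rewrite mem_primes => /and3P[pp _ /dvdn_trans/(_ dk)].
  rewrite Euclid_dvdX // => /andP[+ _].
  by rewrite /b !Euclid_dvdM // !dvdn_prime2 // !inE -!orbA.
apply: primitive_prime_divisor => //.
  move=> p /prd; rewrite !inE => pE; apply: (coprime_dvdl dk); apply: coprimeXl.
  by case/or4P: pE => /eqP->.
(* A crude bound suffices: at most four primes, each at least 11, and [4 / 11 < 1]. *)
apply: (@leq_ltn_trans (\sum_(p <- primes d) d %/ 11)).
  rewrite big_seq [leqRHS]big_seq leq_sum // => p /prd pE.
  by apply: leq_div2l => //; move: pE; rewrite !inE; case/or4P => /eqP->.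
rewrite big_const_seq iter_addn_0 count_predT.
have szp : size (primes d) <= 4 by apply: uniq_leq_size (primes_uniq d) prd.
apply: (@leq_ltn_trans (d %/ 11 * 4)); first by rewrite leq_mul2l szp orbT.
have := leq_divM d 11; lia.
Qed.

(** * Passing from exponent [k] to [2 * k] *)

Lemma num_divisors_odd_part_leq k : 0 < k ->
  num_divisors k`_2^' <= num_divisors (2 ^ k + 1).
Proof.
move=> k0; have m0 : 0 < k`_2^' by rewrite part_gt0.
have p0 : 0 < k`_2 by rewrite part_gt0.
have modd : odd k`_2^'.
  by rewrite odd_2'nat part_pnat.
rewrite {1}/num_divisors -(size_map (fun d => 2 ^ (k`_2 * d) + 1)).
apply: num_divisors_subset => [||_ /mapP[d + ->]]; first by rewrite addn1.
  rewrite map_inj_uniq ?divisors_uniq // => d e /addIn /(expnI (isT : 1 < 2))/eqP.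
  by rewrite eqn_pmul2l // => /eqP.
rewrite -dvdn_divisors // => /dvdnP[j jm].
rewrite -{2}(partnC 2 k0) jm (mulnC j) mulnA (expnM _ (_ * d)).
have {modd jm} : odd j by move: modd; rewrite jm oddM => /andP[].
set y := 2 ^ _ => oj.
have y0 : 0 < y by rewrite expn_gt0.
have -> : j = (j./2).*2.+1 by rewrite -{1}(odd_double_half j) oj.
(* For odd [j], [y + 1] divides [y ^ j + 1]: the exponent [j - 1] is even, so [y ^ 2 - 1] divides
   [y ^ (j - 1) - 1]. *)
rewrite expnS.
have -> : y * y ^ (j./2).*2 + 1 = y * (y ^ (j./2).*2 - 1) + (y + 1).
  by rewrite mulnBr muln1 addnA subnK // leq_pmulr // expn_gt0 y0.
rewrite dvdn_addl // dvdn_mull //.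
apply: dvdn_trans (dvdn_pred_exp y (_ : 2 %| _)); last by rewrite -muln2 dvdn_mull.
have -> : y ^ 2 - 1 = (y - 1) * (y + 1) by rewrite -subn_sqr exp1n.
by rewrite dvdn_mull.
Qed.

Lemma num_divisors_mersenne_double k : 0 < k ->
  num_divisors k`_2^' * num_divisors (2 ^ k - 1) <= num_divisors (2 ^ (2 * k) - 1).
Proof.
move=> k0; have N0 : 0 < 2 ^ k - 1 by rewrite subn_gt0 -{1}(expn0 2) ltn_exp2l.
have -> : 2 ^ (2 * k) - 1 = (2 ^ k + 1) * (2 ^ k - 1).
  by rewrite [RHS]mulnC -subn_sqr exp1n -expnM (mulnC k).
apply: leq_trans (num_divisors_supM _ N0 _);
  rewrite ?leq_mul2r ?num_divisors_odd_part_leq ?orbT //.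
  by rewrite addn1.
have odd1 : odd (2 ^ k - 1) by rewrite oddB ?expn_gt0 // oddX; case: (k) k0.
have -> : 2 ^ k + 1 = 2 + (2 ^ k - 1) by lia.
by rewrite coprime_sym /coprime gcdnDr -/(coprime _ _) coprimen2.
Qed.

(** * Upper bounds from values of cyclotomic polynomials *)

Lemma leq_exp2rW m n e : m <= n -> m ^ e <= n ^ e.
Proof. by case: e => [//|e] mn; rewrite leq_exp2r. Qed.

Lemma prod_cyclotomic_at2 k : 0 < k ->
  \prod_(d <- divisors k) cyclotomic_at2 d = 2 ^ k - 1.
Proof.
move=> k0; have absz_prod : {morph absz : x y / (x * y)%R >-> x * y}.
  exact: abszM.
rewrite /cyclotomic_at2 -(big_morph absz absz_prod (absz_nat 1 : absz 1%R = 1)).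
rewrite -horner_prod.
rewrite prod_Cyclotomic // !hornerE.
have -> : (2 ^+ k - 1 = (2 ^ k - 1)%:R :> int)%R by rewrite natrB ?expn_gt0 // natrX.
by rewrite natz absz_nat.
Qed.

Lemma num_prime_divisors_prod (I : Type) (s : seq I) (F : I -> nat) :
  0 < \prod_(i <- s) F i ->
  num_prime_divisors (\prod_(i <- s) F i) <= \sum_(i <- s) num_prime_divisors (F i).
Proof.
elim: s => [|i s IHs]; rewrite ?big_nil // !big_cons muln_gt0 => /andP[Fi0 Fs0].
rewrite (leq_trans _ (leq_add (leqnn _) (IHs Fs0))) // -size_cat.
apply: uniq_leq_size (primes_uniq _) _ => p.
by rewrite primesM // mem_cat.
Qed.

(** The 2-part of [k] has at most [L] divisors, so [k] has at most [L * C]. Each cyclotomic factor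
    of [2 ^ k - 1] brings at most [K * L] primes, and every exponent is below [k < 2 ^ L]. *)
Lemma num_divisors_mersenne_leq C K L k : 0 < k -> k < 2 ^ L ->
  (forall d, 0 < d -> d < 2 ^ L -> num_prime_divisors (cyclotomic_at2 d) <= K * L) ->
  num_divisors k`_2^' <= C ->
  num_divisors (2 ^ k - 1) <= 2 ^ (C * K * L ^ 3).
Proof.
move=> k0 kL hK hC.
have N0 : 0 < 2 ^ k - 1 by rewrite subn_gt0 -{1}(expn0 2) ltn_exp2l.
have tauk : num_divisors k <= L * C.
  rewrite -{1}(partnC 2 k0).
  apply: leq_trans (num_divisors_subM _ _) _; rewrite ?part_gt0 //.
  rewrite leq_mul // p_part num_divisors_pfactor //.
  by rewrite -(ltn_exp2l _ _ (isT : 1 < 2)) (leq_ltn_trans _ kL) //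
    -p_part dvdn_leq // dvdn_part.
have omegak : num_prime_divisors (2 ^ k - 1) <= L * C * (K * L).
  rewrite -prod_cyclotomic_at2 //.
  apply: leq_trans (num_prime_divisors_prod _) _; first by rewrite prod_cyclotomic_at2.
  apply: (@leq_trans (\sum_(d <- divisors k) K * L)).
    rewrite big_seq [leqRHS]big_seq leq_sum // => d; rewrite -dvdn_divisors // => dk.
    by rewrite hK ?(dvdn_gt0 k0) // (leq_ltn_trans _ kL) // dvdn_leq.
  by rewrite big_const_seq iter_addn_0 count_predT mulnC leq_mul2r tauk orbT.
have lognk p : logn p (2 ^ k - 1) < k.
  case: (boolP (prime p)) => [pp|npp]; last by rewrite lognE (negPf npp).
  rewrite -(ltn_exp2l _ _ (isT : 1 < 2)).
  apply: (@leq_ltn_trans (p ^ logn p (2 ^ k - 1)));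
    first by rewrite leq_exp2rW ?prime_gt1.
  apply: (@leq_ltn_trans (2 ^ k - 1)); first by rewrite dvdn_leq ?pfactor_dvdnn.
  by rewrite -subn_gt0 subKn ?expn_gt0.
apply: leq_trans (num_divisors_leq_exp N0 lognk) _.
apply: (@leq_trans (k ^ (L * C * (K * L)))); first by rewrite leq_pexp2l.
apply: (@leq_trans ((2 ^ L) ^ (L * C * (K * L)))).
  by rewrite leq_exp2rW // ltnW.
rewrite -expnM leq_exp2l //; apply: eq_leq; rewrite !expnS expn0; ring.
Qed.

(** * Comparison of the sums up to [n] and [2 * n] *)

Lemma leq_sum_double (g : nat -> nat) n :
  \sum_(1 <= k < n.+1) g (2 * k) <= \sum_(1 <= k < (2 * n).+1) g k.
Proof.
elim: n => [|n IHn]; first by rewrite muln0 !big_geq.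
rewrite big_nat_recr //= mulnS add2n [leqRHS]big_nat_recr //= leq_add2r.
by rewrite (leq_trans IHn) // [leqRHS]big_nat_recr //= leq_addr.
Qed.

(** Terms whose index has an odd part with at least [C] divisors grow by the factor [C] under
    doubling. The others make up at most half of the sum, which costs the factor 2. *)
Lemma sum_num_divisors_mersenne_superlinear C K :
  (forall d L, 0 < d -> d < 2 ^ L ->
    num_prime_divisors (cyclotomic_at2 d) <= K * L) ->
  exists N, forall n, N <= n ->
    C * sum_num_divisors_mersenne n <= 2 * sum_num_divisors_mersenne (2 * n).
Proof.
(* The final comparison needs [l.+1 + C * K * l.+1 ^ 3 + 2 <= a.+1 ^ 4]. As [l.+1 <= 16 * a.+1], the
   left side is at most [(16 + 2 + 16 ^ 3 * (C * K)) * a.+1 ^ 3]. *)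
move=> hK; exists (2 ^ (16 * (18 + 4096 * (C * K)))) => n nN.
have n0 : 0 < n by rewrite (leq_trans _ nN) // expn_gt0.
pose l := trunc_log 2 n; pose a := l %/ 16.
have nL : n < 2 ^ l.+1 by rewrite trunc_log_ltn.
have lN : 16 * (18 + 4096 * (C * K)) <= l by rewrite trunc_log_max.
pose t k := num_divisors (2 ^ k - 1).
pose good := \sum_(1 <= k < n.+1 | C <= num_divisors k`_2^') t k.
pose bad := \sum_(1 <= k < n.+1 | ~~ (C <= num_divisors k`_2^')) t k.
have fE : sum_num_divisors_mersenne n = good + bad.
  exact: (bigID (fun k => C <= num_divisors k`_2^')).
have good_le : C * good <= sum_num_divisors_mersenne (2 * n).
  apply: leq_trans (leq_sum_double _ _).
  rewrite /good big_distrr /= big_mkcond /= !big_nat leq_sum // => k /andP[k0 _].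
  case: ifP => // Ck; apply: leq_trans (num_divisors_mersenne_double k0).
  by rewrite leq_mul2r Ck orbT.
have bad_le : bad <= 2 ^ (l.+1 + C * K * l.+1 ^ 3).
  apply: (@leq_trans (\sum_(1 <= k < n.+1) 2 ^ (C * K * l.+1 ^ 3))).
    rewrite /bad big_mkcond /= !big_nat leq_sum // => k /andP[k0 kn].
    case: ifP => //; rewrite -ltnNge => /ltnW.
    apply: num_divisors_mersenne_leq => // [|d d0 dL]; last exact: hK.
    exact: leq_ltn_trans nL.
  by rewrite sum_nat_const_nat subn1 expnD leq_mul2r ltnW ?orbT.
have f_ge : 2 ^ (a.+1 ^ 4).-1 <= sum_num_divisors_mersenne n.
  apply: leq_trans (exp2_leq_num_divisors_mersenne a) _.
  set k := _ ^ a.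
  (* This is why [a] is [l %/ 16]: the product [11 * 13 * 17 * 19 = 46189] is below [2 ^ 16]. *)
  have kn : k <= n.
    apply: leq_trans (trunc_logP (isT : 1 < 2) n0).
    apply: (@leq_trans ((2 ^ 16) ^ a)).
      by rewrite leq_exp2rW //; lia.
    by rewrite -expnM leq_exp2l // mulnC leq_divM.
  have k0 : 0 < k by rewrite expn_gt0.
  rewrite /sum_num_divisors_mersenne (bigD1_seq k) ?iota_uniq ?leq_addr //=.
  by rewrite mem_index_iota k0 ltnS.
have half : 2 * bad <= sum_num_divisors_mersenne n.
  apply: leq_trans f_ge; apply: leq_trans (leq_mul (leqnn 2) bad_le) _.
  rewrite -expnS leq_exp2l // -ltnS prednK ?expn_gt0 //.
  have la : l.+1 <= 16 * a.+1 by rewrite mulnC ltn_ceil.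
  have aN : 18 + 4096 * (C * K) <= a.+1.
    by rewrite -(leq_pmul2l (isT : 0 < 16)) (leq_trans lN) // ltnW.
  have : C * K * l.+1 ^ 3 <= C * K * (16 * a.+1) ^ 3
    by rewrite leq_mul2l leq_exp2r ?la ?orbT.
  have : (18 + 4096 * (C * K)) * a.+1 ^ 3 <= a.+1 ^ 4
    by rewrite (expnS _ 3) leq_mul2r aN orbT.
  have a3 : a.+1 <= a.+1 ^ 3 by rewrite -{1}(expn1 a.+1) leq_pexp2l.
  rewrite expnMn; move: (a.+1 ^ 4) (a.+1 ^ 3) (l.+1 ^ 3) (C * K) a3 la => A4 A3 L3 CK.
  nia.
nia.
Qed.

(** * The limit over the reals *)

Local Open Scope classical_set_scope.
Local Open Scope ring_scope.

Theorem theorem3 (R : realType)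
    (homega : finite_set [set d : nat | (2 <= d)%N /\
       ~ ((num_prime_divisors (cyclotomic_at2 d))%:R <= 10 * ln d%:R :> R)]) :
  ((sum_num_divisors_mersenne (2 * n))%:R /
   (sum_num_divisors_mersenne n)%:R : R) @[n --> \oo] --> +oo.
Proof.
have [K hK] : exists K, forall d L, (0 < d)%N -> (d < 2 ^ L)%N ->
    (num_prime_divisors (cyclotomic_at2 d) <= K * L)%N.
  have /finite_seqP[s sE] := homega.
  (* [M] covers the exceptional [d]; for the others with [d >= 2],
     [10 * ln d <= 10 * L * ln 2 <= 20 * L]. *)
  pose M := (\sum_(d <- s) num_prime_divisors (cyclotomic_at2 d))%N.
  exists (M + 20)%N => d L d0 dL.
  have L0 : (0 < L)%N by case: L dL d0 => //; case: d.
  have [ds|/negP ds] := boolP (d \in s).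
    apply: (@leq_trans M); last by nia.
    by rewrite /M (big_rem d) //= leq_addr.
  (* The hypothesis starts at [d = 2]; the value of the first cyclotomic polynomial at 2 is 1, which
     has no prime divisor. *)
  have [d1|d1] := leqP d 1.
    have -> : d = 1%N by apply/eqP; rewrite eqn_leq d1.
    by have := prod_cyclotomic_at2 (isT : (0 < 1)%N); rewrite big_seq1 => ->.
  have : (num_prime_divisors (cyclotomic_at2 d))%:R <= 10 * ln d%:R :> R.
    apply: contrapT => nle; apply: ds.
    by have : [set` s] d by rewrite -sE.
  move=> /le_trans/(_ (_ : _ <= (20 * L)%:R)) le20.
  rewrite -(ler_nat R) (le_trans (le20 _)) ?ler_nat ?leq_mul2r ?leq_addl ?orbT //.
  have lnd : ln d%:R <= L%:R * 2 :> R.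
    apply: (@le_trans _ _ (ln (2 ^+ L))).
      by rewrite ler_ln ?posrE ?exprn_gt0 ?ltr0n // -natrX ler_nat ltnW.
    rewrite lnXn // -[ln 2 *+ L]mulr_natl ler_wpM2l //; apply/ltW.
    exact: ln_sublinear.
  rewrite natrM; lra.
(* Taking [C] above [2 * A] absorbs the factor 2 of the growth bound. *)
apply/cvgryPge => A; have [N hN] := sum_num_divisors_mersenne_superlinear
  (Num.bound `|2 * A|) hK.
near=> n.
have n0 : (0 < n)%N by near: n; exact: nbhs_infty_gt.
have f0 : (0 < sum_num_divisors_mersenne n)%N.
  by rewrite /sum_num_divisors_mersenne big_ltn.
rewrite ler_pdivlMr ?ltr0n //.
have : (Num.bound `|2 * A| * sum_num_divisors_mersenne n)%:R <=
    (2 * sum_num_divisors_mersenne (2 * n))%:R :> R.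
  by rewrite ler_nat hN //; near: n; exact: nbhs_infty_ge.
rewrite !natrM.
have : 2 * A <= (Num.bound `|2 * A|)%:R.
  by rewrite (le_trans (ler_norm _)) // ltW // archi_boundP.
have : 0 < (sum_num_divisors_mersenne n)%:R :> R by rewrite ltr0n.
nra.
Unshelve. all: by end_near.
Qed.
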